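(* Consider the $GI/M/c$ queueing model with one-step transition probabilities $p(i,j)$ of the Markov chain imbedded at pre-arrival instants. For all integers $i,j$ with $j>0$ and $j+1\le c\le i$, \[ p(i,j)=\sum_{k=1}^{c-j}\frac{(-1)^{c-j-k}(c-1)!}{(k-1)!\,(c-j-k)!\,j!}\left(\frac{c}{k}\right)^{i-c+2}\left[A^*((c-k)\mu)-\sum_{r=0}^{i-c+1}\frac{(k\mu)^r A^*_r(c\mu)}{r!}\right]. \]
   Context: The $GI/M/c$ model: customers arrive one at a time to an infinite-capacity system with $c\ge 1$ parallel identical servers. Inter-arrival times are i.i.d. with distribution function $A(t)$ on $[0,\infty)$ and mean $1/\lambda$; service times are i.i.d. exponential with mean $1/\mu$, $\mu>0$, independent of the arrivals. When $n$ customers are present the total service rate is $\min(n,c)\mu$. Let $X_n$ ($n=0,1,\dots$) be the number of customers in the system just before the $n$-th arrival; $\{X_n\}$ is a Markov chain and $p(i,j)=P\{X_n=j\mid X_{n-1}=i\}$ for $i,j\ge 0$. So $X_{n+1}=X_n+1-D_n$, where $D_n$ is the number of services completed during the $n$-th inter-arrival time. These probabilities have the well-known integral representations: for $0\le j\le i+1\le c$, $p(i,j)=\int_0^\infty\binom{i+1}{i-j+1}e^{-\mu tj}(1-e^{-\mu t})^{i-j+1}dA(t)$; for $c\le j\le i+1$, $p(i,j)=\int_0^\infty \frac{e^{-c\mu t}(c\mu t)^{i-j+1}}{(i-j+1)!}dA(t)$; for $j+1\le c\le i$, $p(i,j)=\binom{c}{c-j}\frac{(c\mu)^{i-c+1}}{(i-c)!}\int_0^\infty\int_0^t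 v^{i-c}e^{-\mu(t-v)j-c\mu v}(1-e^{-\mu(t-v)})^{c-j}\,dv\,dA(t)$; and $p(i,j)=0$ otherwise. The Laplace--Stieltjes transform of $A$ is $A^*(s)=\int_0^\infty e^{-st}dA(t)$, and $A^*_n(s)=(-1)^n\frac{d^nA^*(s)}{ds^n}=\int_0^\infty t^ne^{-st}dA(t)$ for $n\ge 0$, with $A^*_0=A^*$. *)

(* Defs.v *)
From HB Require Import structures.
From mathcomp Require Import all_boot all_order all_algebra.
From mathcomp Require Import all_classical all_reals all_analysis.

Set Implicit Arguments.
Unset Strict Implicit.
Unset Printing Implicit Defensive.

Import Order.TTheory GRing.Theory Num.Theory.
Import numFieldNormedType.Exports.

Local Open Scope classical_set_scope.
Local Open Scope ring_scope.

Section Independence.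
Context d (Omega : measurableType d) (R : realType) (P : probability Omega R).

(* [F i] is the class of events carried by the index [i] (typically the
   sigma-algebra generated by a random variable). *)
Definition mutually_independent (I : eqType) (F : I -> set (set Omega)) : Prop :=
  forall (J : seq I) (E : I -> set Omega), uniq J ->
    (forall i, i \in J -> F i (E i)) ->
    P (\bigcap_(i in [set` J]) E i) = (\prod_(i <- J) P (E i))%E.

Definition cond_prob (E F : set Omega) : R := fine (P (E `&` F)) / fine (P F).

End Independence.

Section LaplaceStieltjes.
Context (R : realType) (A : probability R R).

(* A^*_n(s) = \int_0^oo t^n e^{-st} dA(t) *)
Definition lst_moment (n : nat) (s : R) : R :=
  \int[A]_(t in `[0, +oo[) (t ^+ n * expR (- (s * t))).

Definition lst (s : R) : R := \int[A]_(t in `[0, +oo[) expR (- (s * t)).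

End LaplaceStieltjes.

Section DeathProcess.
Context (R : realType).

(* Between two arrivals the number of customers only decreases, one service
   completion at a time; [h m] is the time spent with exactly [m] customers
   present.  Starting with [m] customers, the [k]-th completion occurs at time
   h m + h (m - 1) + ... + h (m - k + 1). *)
Definition completion_time (h : nat -> R) (m k : nat) : R :=
  \sum_(0 <= l < k) h (m - l)%N.

Definition completions (h : nat -> R) (m : nat) (t : R) : nat :=
  (\sum_(1 <= k < m.+1) (completion_time h m k <= t)%R)%N.

End DeathProcess.

(* The law of the inter-arrival times is given by the probability measure [A]
   on the real line, i.e. the Stieltjes measure dA of their distribution
   function.

   While m > 0 customers are present, min(m, c) servers are busy, each
   completing services at exponential rate [mu]; by lack of memory (also at
   arrival instants) the time until the next completion is exponential with
   the total service rate min(m, c) * mu, independently of the past.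
   [holding n m] is this time for the n-th inter-arrival period. *)
Record GIMc d (Omega : measurableType d) (R : realType)
    (P : probability Omega R) (c : nat) (lambda mu : R) (A : probability R R) :=
  MkGIMc {
    initial : {RV P >-> nat};
    interarrival : nat -> {RV P >-> R};
    holding : nat -> nat -> {RV P >-> R};
    servers_gt0 : (0 < c)%N;
    lambda_gt0 : 0 < lambda;
    mu_gt0 : 0 < mu;
    A_nonneg : A `[0, +oo[%classic = 1%E;
    A_mean : (\int[A]_(t in `[0%R, +oo[) t%:E = (lambda^-1)%:E)%E;
    interarrival_law : forall n (B : set R), measurable B ->
      distribution P (interarrival n) B = A B;
    holding_law : forall n m (B : set R), (0 < m)%N -> measurable B ->
      distribution P (holding n m) B = exponential_prob ((minn m c)%:R * mu) B;
    inputs_independent :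
      mutually_independent P (fun i : unit + (nat + nat * nat) =>
        match i with
        | inl _ => preimage_set_system setT initial measurable
        | inr (inl n) => preimage_set_system setT (interarrival n) measurable
        | inr (inr (n, m)) => preimage_set_system setT (holding n m) measurable
        end)
  }.

Section Queue.
Context d (Omega : measurableType d) (R : realType) (P : probability Omega R).
Context (c : nat) (lambda mu : R) (A : probability R R).
Variable M : GIMc P c lambda mu A.

(* X_n, the number of customers just before the n-th arrival:
   X_{n+1} = X_n + 1 - D_n. *)
Fixpoint queue_length (n : nat) (w : Omega) : nat :=
  if n is k.+1 then
    let m := (queue_length k w).+1 in
    (m - completions (fun l => holding M k l w) m (interarrival M k w))%N
  else initial M w.

(* P{X_{n+1} = j | X_n = i} *)
Definition transition_prob (n i j : nat) : R :=
  cond_prob P [set w | queue_length n.+1 w = j] [set w | queue_length n w = i].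

End Queue.

(* Main.v *)
Require Import Defs.
From HB Require Import structures.
From mathcomp Require Import all_boot all_order all_algebra.
From mathcomp Require Import all_classical all_reals all_analysis.
From mathcomp Require Import measurable_realfun ring lra zify.

Set Implicit Arguments.
Unset Strict Implicit.
Unset Printing Implicit Defensive.

Import Order.TTheory GRing.Theory Num.Theory.
Import numFieldNormedType.Exports.

Local Open Scope classical_set_scope.
Local Open Scope ring_scope.

(** An arrival that finds i customers leaves m = i + 1 of them.  Until the next
    arrival, after a time T, the queue is a pure death process: it leaves
    level l after an exponential time of rate min(l, c) mu.  If S_k denotes the
    time of the k-th departure, the next arrival finds j customers, 0 < j < m,
    exactly when S_(m-j) <= T < S_(m-j+1), up to a null event.

    Independence removes the conditioning.  The event X_n = i depends only on
    the inputs of the periods before n, the departures only on those of period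
    n, and classes of events generated by disjoint groups of independent inputs
    are independent ([events_of_independent]).  The same grouping principle
    makes S_k independent of T, so that P(S_k <= T) is the integral against A
    of the distribution function of S_k ([prob_le_independent]), and makes S_k
    independent of the next holding time.

    The distribution functions are not computed as convolutions but verified.
    If X has distribution function F on [0, +oo[ and Y is an independent
    exponential time of rate r, then any H with H' = r (F - H) and H 0 = 0 is
    the distribution function of X + Y ([pos_cdf_add]).  So it suffices to
    exhibit functions p_l, the probabilities of being at level l at time t,
    that solve the forward equations
      p_l' = rate (l + 1) p_(l+1) - rate l p_l
    with all the mass at level m at time 0: then S_k has distribution function
    1 - (p_m + ... + p_(m-k+1)).  With a = i - c + 1, the levels l >= c, which
    all have rate c mu, carry Poisson probabilities, and a level j < c carries
      sum_k C(j,k) (c/k)^(a+1) (e^(-(c-k) mu t)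
                   - sum_(r <= a) (k mu t)^r e^(-c mu t) / r!).
    The bracket decays at rate (c - k) mu and has a source proportional to
    k^(a+1); the factor (c/k)^(a+1) makes that source the flow out of level c,
    the same for every k.  Hence the forward equations below c come down to two
    identities: the C(j,k), whose signs alternate in k, sum to 0 unless
    j = c - 1 ([sum_level_coef]), and (c - j - k) C(j,k) = - (j + 1) C(j+1,k)
    ([level_coefS]).

    Finally P(S_(m-j) <= T) - P(S_(m-j+1) <= T) is the integral of p_j against
    A, and integrating p_j term by term produces the transforms of A. *)

(** * Independence of events generated by disjoint groups of inputs *)

Section Grouping.
Context d (Omega : measurableType d) (R : realType) (P : probability Omega R).

(** Independence from a fixed event B passes from a pi-system to the
    sigma-algebra it generates: the events independent of B form a
    lambda-system. *)
Lemma independent_of_generated (G : set (set Omega)) (B : set Omega) :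
  setI_closed G -> G `<=` measurable -> measurable B ->
  (forall E, G E -> P (E `&` B) = (P E * P B)%E) ->
  forall E, <<s G >> E -> P (E `&` B) = (P E * P B)%E.
Proof.
move=> GI Gm mB GB.
pose H := [set E | measurable E /\ P (E `&` B) = (P E * P B)%E].
suff sGH : <<s G >> `<=` H by move=> E /sGH[].
have fin E : measurable E -> P E \is a fin_num by exact: fin_num_measure.
apply: lambda_system_subset => //; last 1 first.
  by move=> E GE; split; [exact: Gm|exact: GB].
split => //.
- by split; [exact: measurableT|rewrite setTI probability_setT mul1e].
- move=> E F FE [mE EB] [mF FB]; split; first exact: measurableD.
  rewrite (_ : (E `\` F) `&` B = (E `&` B) `\` (F `&` B)); last first.
    apply/seteqP; split=> [w [[Ew nFw] Bw]|w [[Ew Bw] nFB]]; first by split=> // -[].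
    by split=> //; split=> // Fw; apply: nFB.
  rewrite !measureD ?ltey_eq ?fin//; try exact: measurableI.
  rewrite (setIidr FE) (setIidr (setSI FE)) [X in (X - _)%E]EB [X in (_ - X)%E]FB.
  by rewrite muleBl ?fin// fin_num_adde_defr// fin.
- move=> F ndF HF; have mF k : measurable (F k) by have [] := HF k.
  split; first exact: bigcupT_measurable.
  have mFB k : measurable (F k `&` B) by exact: measurableI.
  rewrite setI_bigcupl.
  have cvB : P (F k `&` B) @[k --> \oo] --> P (\bigcup_k (F k `&` B)).
    apply: (nondecreasing_cvg_mu mFB); first exact: bigcupT_measurable.
    by move=> m n mn; apply/subsetPset; apply: setSI; exact/subsetPset/ndF.
  have cvF : P (F k) @[k --> \oo] --> P (\bigcup_k (F k)).
    by apply: (nondecreasing_cvg_mu mF) => //; exact: bigcupT_measurable.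
  have cvFB : (P (F k) * P B)%E @[k --> \oo] --> (P (\bigcup_k (F k)) * P B)%E.
    by apply: cvgeZr => //; exact: fin.
  rewrite -(cvg_lim _ cvB)// -(cvg_lim _ cvFB)//.
  by apply: congr_lim; apply/funext => k; exact: (HF k).2.
Qed.

Context (I : eqType) (F : I -> set (set Omega)).

Definition events_of (U : set I) : set (set Omega) :=
  <<s \bigcup_(i in U) F i >>.

Lemma events_of_sub (U : set I) i E : U i -> F i E -> events_of U E.
Proof. by move=> Ui FE; apply: sub_sigma_algebra; exists i. Qed.

Lemma events_ofS (U V : set I) : U `<=` V -> events_of U `<=` events_of V.
Proof. by move=> UV; apply: sub_sigma_algebra2; exact: bigcup_subset. Qed.

Hypothesis Fm : forall i, F i `<=` measurable.
Hypothesis FI : forall i, setI_closed (F i).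
Hypothesis indF : mutually_independent P F.

(** The finite intersections of events of the classes indexed by [U]: the
    pi-system on which mutual independence is a product rule. *)
Definition cylinders (U : set I) : set (set Omega) :=
  [set E | exists J (f : I -> set Omega), [/\ uniq J,
     forall i, i \in J -> U i /\ F i (f i) & E = \bigcap_(i in [set` J]) f i]].

Lemma cylinders_setI (U : set I) : setI_closed (cylinders U).
Proof.
move=> _ _ [J [f [uJ Jf ->]]] [K [g [uK Kg ->]]].
exists (undup (J ++ K)).
(* An index constrained on both sides must satisfy both constraints. *)
exists (fun i => if i \in J then if i \in K then f i `&` g i else f i else g i).
split; first exact: undup_uniq.
  move=> i; rewrite mem_undup mem_cat; case: ifPn => [iJ _|_ /= iK]; last exact: Kg.
  have [Ui Ff] := Jf _ iJ; split=> //.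
  by case: ifPn => // iK; apply: FI => //; have [] := Kg _ iK.
apply/seteqP; split => w /=.
  move=> [wJ wK] i /=; rewrite mem_undup mem_cat.
  case: ifPn => [iJ _|_ /= iK]; last exact: wK.
  by case: ifPn => iK; [split; [exact: wJ|exact: wK]|exact: wJ].
move=> wJK; split => i /= iJK.
  have := wJK i; rewrite /= mem_undup mem_cat iJK => /(_ isT).
  by case: ifP => // _ [].
have := wJK i; rewrite /= mem_undup mem_cat iJK orbT => /(_ isT).
by case: ifP => // _ [].
Qed.

Lemma cylinders_measurable (U : set I) : cylinders U `<=` measurable.
Proof.
move=> _ [J [f [uJ Jf ->]]]; apply: fin_bigcap_measurable => //.
by move=> i iJ; apply: (Fm (i := i)); have [] := Jf i iJ.
Qed.

Lemma events_of_cylinders (U : set I) : events_of U `<=` <<s cylinders U >>.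
Proof.
apply: sub_sigma_algebra2 => E [i Ui FE]; exists [:: i], (fun=> E); split => //.
  by move=> k; rewrite inE => /eqP ->.
by apply/seteqP; split => w //=; [move=> ? k|apply; rewrite /= inE].
Qed.

Lemma events_of_measurable (U : set I) : events_of U `<=` measurable.
Proof.
apply: smallest_sub; first exact: sigma_algebra_measurable.
by move=> E [i _]; exact: Fm.
Qed.

(** The grouping principle.  On cylinders it is the product rule for the
    concatenation of the two index lists; the pi-lambda argument is then applied
    on each side in turn. *)
Lemma events_of_independent (U V : set I) E1 E2 : U `&` V = set0 ->
  events_of U E1 -> events_of V E2 -> P (E1 `&` E2) = (P E1 * P E2)%E.
Proof.
move=> UV0 UE1 VE2.
apply: (independent_of_generated (@cylinders_setI U)); last exact: events_of_cylinders.
- exact: cylinders_measurable.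
- exact: events_of_measurable VE2.
move=> {UE1}E1 UE1; rewrite setIC muleC.
apply: (independent_of_generated (@cylinders_setI V)); last exact: events_of_cylinders.
- exact: cylinders_measurable.
- exact: cylinders_measurable UE1.
move=> {VE2}E2 [K [g [uK Kg ->]]]; case: UE1 => J [f [uJ Jf ->]].
have JK i : i \in J -> i \notin K.
  move=> iJ; apply/negP => iK; suff : (U `&` V) i by rewrite UV0.
  by split; [exact: (Jf i iJ).1|exact: (Kg i iK).1].
have uKJ : uniq (K ++ J).
  by rewrite cat_uniq uK uJ andbT /=; apply/hasPn => i /JK.
pose h i := if i \in K then g i else f i.
have hK i : i \in K -> h i = g i by rewrite /h => ->.
have hJ i : i \in J -> h i = f i by rewrite /h => /JK /negbTE ->.
have -> : \bigcap_(i in [set` K]) g i = \bigcap_(i in [set` K]) h i.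
  by apply: eq_bigcapr => i iK; rewrite hK.
have -> : \bigcap_(i in [set` J]) f i = \bigcap_(i in [set` J]) h i.
  by apply: eq_bigcapr => i iJ; rewrite hJ.
have Fh i : i \in K ++ J -> F i (h i).
  rewrite mem_cat => /orP[iK|iJ]; first by rewrite hK//; have [] := Kg i iK.
  by rewrite hJ//; have [] := Jf i iJ.
rewrite (indF uK) => [|i iK]; last by apply: Fh; rewrite mem_cat iK.
rewrite (indF uJ) => [|i iJ]; last by apply: Fh; rewrite mem_cat iJ orbT.
rewrite -big_cat /= -(indF uKJ)//; congr (P _).
rewrite -bigcap_setU; congr (\bigcap_(i in _) _).
by apply/seteqP; split => i /=; rewrite mem_cat => /orP.
Qed.

(** The sample space seen with the sigma-algebra generated by the inputs in
    [U], so that measurability lemmas prove membership in [events_of]. *)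
Definition events_type (U : set I) := g_sigma_algebraType (\bigcup_(i in U) F i).

End Grouping.

(** * Independent pairs and exponential laws *)

(** Keeps both measurable types as parameters: the real line comes with two
    measurable structures that have the same measurable sets but are distinct,
    and the one intended for the codomain sometimes has to be imposed. *)
Definition mfun_of d d' (T : measurableType d) (T' : measurableType d')
  (f : T -> T') (mf : measurable_fun setT f) : {mfun T >-> T'} :=
  mfun_Sub (mem_set mf).

Section IndependentPair.
Context d (Omega : measurableType d) (R : realType) (P : probability Omega R).
Context (X Y : {RV P >-> R}).
Hypothesis XY : forall B C : set R, measurable B -> measurable C ->
  P (X @^-1` B `&` Y @^-1` C) = (P (X @^-1` B) * P (Y @^-1` C))%E.

(** The joint law of an independent pair is the product of the marginal laws,
    so conditioning on the value of Y amounts to integrating sections. *)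
Lemma prob_le_independent (g : R -> R) : measurable_fun setT g ->
  P [set w | X w <= g (Y w)] =
  (\int[distribution P Y]_y P [set w | X w <= g y]%R)%E.
Proof.
move=> mg; pose C := [set z : R * R | z.2 <= g z.1].
have mC : measurable C.
  rewrite -[C]setTI.
  apply: (measurable_fun_le measurableT measurable_snd).
  exact: (measurableT_comp mg measurable_fst).
pose YX w := (Y w, X w).
have mYX : measurable_fun setT YX by exact: measurable_fun_pair.
pose law := distribution P (mfun_of mYX).
have lawE B1 B2 : measurable B1 -> measurable B2 ->
    law (B1 `*` B2) = (distribution P Y B1 * distribution P X B2)%E.
  move=> mB1 mB2; rewrite muleC -XY//; congr (P _).
  by apply/seteqP; split=> w [].
transitivity (law C) => //.
rewrite -[LHS](product_measure_unique lawE mC).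
apply: eq_integral => y _; rewrite /= /distribution /pushforward /=; congr (P _).
by apply/seteqP; split=> w /=; rewrite xsectionE.
Qed.

End IndependentPair.

Section Exponential.
Context (R : realType).
Notation mu := (@lebesgue_measure R).

Lemma exponential_prob_dominates (r : R) (r_gt0 : 0 < r) :
  exponential_prob r `<< mu.
Proof.
apply/null_content_dominatesP => A mA muA0; rewrite /exponential_prob.
apply: null_set_integral => //.
by apply/measurable_EFinP/measurable_funTS; exact: measurable_exponential_pdf.
Qed.

(** By uniqueness, the density is almost everywhere the Radon-Nikodym
    derivative, for which the change of variables is available. *)
Lemma integral_exponential_prob (r : R) (f : R -> R) (r_gt0 : 0 < r) :
  (exponential_prob r).-integrable setT (EFin \o f) ->
  (\int[exponential_prob r]_x (f x)%:E =
   \int[mu]_(x in `[0%R, +oo[) (f x * (r * expR (- r * x)))%:E)%E.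
Proof.
move=> intf; have dom := exponential_prob_dominates r_gt0.
have mpdf : measurable_fun setT (EFin \o exponential_pdf r).
  by apply/measurable_EFinP; exact: measurable_exponential_pdf.
rewrite -(Radon_Nikodym_change_of_variables dom)//=.
transitivity (\int[mu]_x ((f x)%:E * (exponential_pdf r x)%:E))%E; last first.
  rewrite [RHS]integral_mkcond; apply: eq_integral => x _.
  rewrite /exponential_pdf !patchE; case: ifPn => _; first by rewrite EFinM.
  by rewrite mule0.
apply: ae_eq_integral => //.
- by apply: emeasurable_funM => //; exact: measurable_int intf.
- by apply: emeasurable_funM => //; exact: measurable_int intf.
- apply: ae_eqe_mul2l => /=.
  rewrite Radon_NikodymE/=; case: cid => /= h [h1 h2 h3].
  apply: integral_ae_eq => //=.
  by move=> E _ mE; rewrite -h3.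
Qed.
End Exponential.

(** * Adding an exponential stage *)

Section Convolution.
Context d (Omega : measurableType d) (R : realType) (P : probability Omega R).
Notation mu := (@lebesgue_measure R).

(** The distribution function of a nonnegative random variable.  Only the
    values of F on [0, +oo[ matter, which allows F to be a smooth function on
    the whole line, as the differential equations below require. *)
Definition pos_cdf (X : Omega -> R) (F : R -> R) : Prop :=
  forall t, P [set w | X w <= t] = (if 0 <= t then F t else 0)%:E.

(** The convolution of F with the exponential density is the solution of the
    relaxation equation H' = r (F - H) started at 0. *)
Lemma convolution_integral (r : R) (F H : R -> R) (t : R) : 0 < t ->
  continuous F -> (forall x : R, is_derive x 1 H (r * (F x - H x))) -> H 0 = 0 ->
  (\int[mu]_(x in `[0%R, t]) (F (t - x) * (r * expR (- r * x)))%:E = (H t)%:E)%E.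
Proof.
move=> t0 cF dH H0.
(* In the derivative of this product the two terms in H cancel, which leaves
   the integrand. *)
pose G x := - (H (t - x) * expR (- r * x)).
have dG (x : R) : is_derive x 1 G (F (t - x) * (r * expR (- r * x))).
  have h1 : is_derive (x : R) 1 (fun x => t - x) (- 1).
    by apply: is_derive_eq; rewrite add0r mul1r.
  have h2 : is_derive (x : R) 1 (H \o (fun x => t - x))
      (r * (F (t - x) - H (t - x)) * - 1).
    by apply: is_derive1_comp.
  have h3 : is_derive (x : R) 1 (fun x => - r * x) (- r).
    by apply: is_derive_eq; rewrite /GRing.scale/= mulr1.
  have h4 : is_derive (x : R) 1 (expR \o (fun x => - r * x)) (expR (- r * x) * - r).
    by apply: is_derive1_comp.
  have h5 := is_deriveM h2 h4.
  have h6 := is_deriveN h5.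
  apply: is_derive_eq.
  rewrite /GRing.scale /=; ring.
have cG : continuous G.
  move=> x; apply: differentiable_continuous; apply/derivable1_diffP.
  by have [] := dG x.
rewrite (@continuous_FTC2 _ _ G)//; last first.
- by move=> x _; rewrite derive1E; have [_ ->] := dG x.
- split.
  + by move=> x _; have [] := dG x.
  + by apply: cvg_at_right_filter; exact: cG.
  + by apply: cvg_at_left_filter; exact: cG.
- apply: continuous_subspaceT => x.
  apply: cvgM.
    apply: (@continuous_comp _ _ _ (fun x => t - x) F); last exact: cF.
    by apply: cvgB => //; exact: cvg_cst.
  apply: cvgM; first exact: cvg_cst.
  apply: (@continuous_comp _ _ _ (fun x => - r * x) expR); last exact: continuous_expR.
  by apply: cvgM => //; exact: cvg_cst.
rewrite /G subrr subr0 H0 mul0r mulr0 expR0 mulr1 -EFinB; congr EFin; ring.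
Qed.

(** Adding an exponential stage to X, given its distribution function as a
    solution of a differential equation, so that closed forms only have to be
    differentiated. *)
Lemma pos_cdf_add (X Y : {RV P >-> R}) (r : R) (F H : R -> R) : 0 < r ->
  (forall B C : set R, measurable B -> measurable C ->
    P (X @^-1` B `&` Y @^-1` C) = (P (X @^-1` B) * P (Y @^-1` C))%E) ->
  (forall B : set R, measurable B -> distribution P Y B = exponential_prob r B) ->
  continuous F -> (forall x : R, is_derive x 1 H (r * (F x - H x))) -> H 0 = 0 ->
  pos_cdf X F -> pos_cdf (X \+ Y) H.
Proof.
move=> r0 XY lawY cF dH H0 XF t.
pose f y := if 0 <= t - y then F (t - y) else 0.
have fE y : P [set w | X w <= t - y] = (f y)%:E by rewrite XF.
have f01 y : 0 <= f y <= 1.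
  rewrite -!lee_fin -fE measure_ge0 probability_le1//.
  rewrite -[X in measurable X]setTI.
  exact: (measurable_fun_le measurableT).
have cont_sub : continuous (fun y : R => t - y).
  by move=> y; apply: cvgB => //; exact: cvg_cst.
have mf : measurable_fun setT f.
  apply: measurable_fun_ifT => //.
    apply: measurable_fun_ler => //.
    exact: continuous_measurable_fun.
  apply: continuous_measurable_fun => y.
  by apply: (@continuous_comp _ _ _ (fun x => t - x) F); [exact: cont_sub|exact: cF].
rewrite (_ : [set w | _] = [set w | X w <= t - Y w]); last first.
  by apply/seteqP; split=> w /=; rewrite lerBrDr.
rewrite (prob_le_independent XY (g := fun y => t - y)); last first.
  exact: continuous_measurable_fun.
transitivity (\int[exponential_prob r]_y (f y)%:E)%E.
  under eq_integral do rewrite fE.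
  have mY : measurable_fun setT (Y : Omega -> measurableTypeR R).
    by move=> _ B mB; rewrite setTI; exact: (measurable_funPTI Y).
  (* The exponential law is a measure for the Borel structure generated by
     half-open intervals; Y has to be retyped before the laws can be compared. *)
  pose Y' := @mfun_of _ _ Omega (measurableTypeR R) Y mY.
  have f0 y : (0 <= (f y)%:E)%E by rewrite lee_fin; case/andP: (f01 y).
  transitivity (\int[distribution P Y']_y (f y)%:E)%E.
    rewrite ge0_integral_distribution//; last exact/measurable_EFinP.
    by rewrite ge0_integral_distribution//; exact/measurable_EFinP.
  have h B : measurable B -> B `<=` setT ->
      distribution P Y' B = exponential_prob r B by move=> mB _; exact: lawY.
  by rewrite (eq_measure_integral _ h).
rewrite integral_exponential_prob//; last first.
  apply: (@le_integrable _ _ _ _ _ _ _ (cst 1%E)) => //=.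
  - exact/measurable_EFinP.
  - by move=> x _; have /andP[? ?] := f01 x; rewrite lee_fin ger0_norm// normr1.
  - exact: finite_measure_integrable_cst.
have [t0|t0|t0] := ltgtP 0 t.
- rewrite -(convolution_integral t0 cF dH H0).
  rewrite integral_mkcond [RHS]integral_mkcond; apply: eq_integral => x _.
  rewrite !patchE /f !mem_setE !in_itv/= andbT subr_ge0.
  by case: (0 <= x) => //=; case: (x <= t) => //; rewrite mul0r.
- rewrite integral0_eq// => x; rewrite /= in_itv/= andbT => x0.
  by rewrite /f ifF ?mul0r//; apply/negbTE; rewrite -ltNge; lra.
(* At t = 0 the integrand is supported by a single point. *)
- rewrite -t0 H0; transitivity (\int[mu]_(x in [set 0%R]) (F 0 * r)%:E)%E; last first.
    by rewrite integral_set1.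
  rewrite integral_mkcond [RHS]integral_mkcond; apply: eq_integral => x _.
  rewrite !patchE /f -t0 sub0r !mem_setE in_itv/= andbT oppr_ge0.
  rewrite (_ : (x \in [set 0]) = (x == 0)); last by apply/idP/eqP; rewrite in_setE.
  case: (ltgtP 0 x) => x0/=.
  + by rewrite mul0r.
  + by [].
  + by rewrite -x0 mulr0 oppr0 expR0 mulr1.
Qed.
End Convolution.

(** * Poisson terms and their tails *)

Section LevelProbabilities.
Context (R : realType).
Implicit Types (t w nu : R).

(** For w = nu, the probability of r departures by time t when departures
    occur at rate nu. *)
Definition poisson_term w nu (r : nat) t : R :=
  (w * t) ^+ r * expR (- (nu * t)) / (r`!)%:R.

Lemma is_derive_expRN nu t :
  is_derive t 1 (fun t => expR (- (nu * t))) (- nu * expR (- (nu * t))).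
Proof.
have h : is_derive t 1 (fun t => - (nu * t)) (- nu).
  by apply: is_derive_eq; rewrite /GRing.scale/= mulr1.
have := @is_derive1_comp _ expR (fun t => - (nu * t)) t _ _ (is_derive_expR _) h.
by rewrite mulrC.
Qed.

Lemma is_derive_poisson_term0 w nu t :
  is_derive t 1 (poisson_term w nu 0) (- nu * poisson_term w nu 0 t).
Proof.
rewrite (_ : poisson_term w nu 0 = fun t => expR (- (nu * t))).
  exact: is_derive_expRN.
by apply/funext => s; rewrite /poisson_term expr0 mul1r divr1.
Qed.

Lemma is_derive_poisson_term w nu r t :
  is_derive t 1 (poisson_term w nu r.+1)
    (w * poisson_term w nu r t - nu * poisson_term w nu r.+1 t).
Proof.
have h1 : is_derive t 1 (fun t => w * t) w.
  by apply: is_derive_eq; rewrite /GRing.scale/= mulr1.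
have h2 := is_deriveX r.+1 h1.
have h3 := is_deriveM h2 (is_derive_expRN nu t).
have h4 := is_deriveZ ((r.+1)`!%:R^-1) h3.
have e : ((r.+1)`!%:R^-1 : R) \*:
   (((fun t => w * t) ^+ r.+1) * (fun t => expR (- (nu * t)))) = poisson_term w nu r.+1.
  apply/funext => s; rewrite /poisson_term [in RHS]mulrC /GRing.scale/=.
  by congr (_ * (_ * _)); rewrite fctE.
rewrite e in h4; apply: is_derive_eq; rewrite /poisson_term /GRing.scale/= fctE.
rewrite factS natrM !exprS.
by field; rewrite nat1r !pnatr_eq0 -lt0n fact_gt0.
Qed.

Lemma is_derive_sum_seq (I : eqType) (s : seq I) (f : I -> R -> R) (df : I -> R) t :
  (forall k, k \in s -> is_derive t 1 (f k) (df k)) ->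
  is_derive t 1 (fun t => \sum_(k <- s) f k t) (\sum_(k <- s) df k).
Proof.
elim: s => [|k s IH] dfk.
  rewrite big_nil (_ : (fun t => _) = cst 0); first exact: is_derive_cst.
  by apply/funext => u; rewrite big_nil.
rewrite big_cons (_ : (fun t => _) = f k + (fun t => \sum_(k <- s) f k t)).
  apply: is_deriveD; first by apply: dfk; rewrite inE eqxx.
  by apply: IH => l ls; apply: dfk; rewrite inE ls orbT.
by apply/funext => u; rewrite big_cons.
Qed.

(** Times (nu / w)^a, for 0 < w < nu, this is the probability that a stages of
    rate nu are over at time t while a last stage of rate nu - w is running.
    As a power series in w it is e^(-nu t) times the remainder of order a of
    e^(w t). *)
Definition poisson_tail w nu (a : nat) t : R :=
  expR (- ((nu - w) * t)) - \sum_(0 <= r < a) poisson_term w nu r t.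

(** The derivatives of the Poisson terms telescope: the partial sum loses only
    its last term. *)
Lemma is_derive_poisson_tail w nu a t :
  is_derive t 1 (poisson_tail w nu a.+1)
    (w * poisson_term w nu a t - (nu - w) * poisson_tail w nu a.+1 t).
Proof.
have h b : is_derive t 1 (fun t => \sum_(0 <= r < b.+1) poisson_term w nu r t)
    (w * (\sum_(0 <= r < b) poisson_term w nu r t) -
     nu * \sum_(0 <= r < b.+1) poisson_term w nu r t).
  elim: b => [|b IH].
    rewrite big_nil mulr0 sub0r big_nat1 -mulNr.
    rewrite (_ : (fun t => _) = poisson_term w nu 0).
      exact: is_derive_poisson_term0.
    by apply/funext => u; rewrite big_nat1.
  rewrite (_ : (fun t => _) = (fun t => \sum_(0 <= r < b.+1) poisson_term w nu r t)
     + poisson_term w nu b.+1); last first.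
    by apply/funext => u; rewrite big_nat_recr.
  have := is_deriveD IH (is_derive_poisson_term w nu b t).
  move=> hD; apply: is_derive_eq.
  rewrite [in RHS]big_nat_recr//= [in X in _ = _ - X]big_nat_recr//=; ring.
have := is_deriveB (is_derive_expRN (nu - w) t) (h a).
move=> hB; apply: is_derive_eq.
rewrite /poisson_tail big_nat_recr//=; ring.
Qed.

Lemma poisson_term_at0 w nu r : poisson_term w nu r 0 = (r == 0%N)%:R.
Proof.
rewrite /poisson_term !mulr0 oppr0 expR0 mulr1 expr0n.
by case: r => [|r]; rewrite /= ?divr1 ?mul0r.
Qed.

Lemma poisson_tail_at0 w nu a : poisson_tail w nu a.+1 0 = 0.
Proof.
rewrite /poisson_tail mulr0 oppr0 expR0 big_nat_recl//= big1_seq.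
  by rewrite poisson_term_at0 addr0 subrr.
by move=> r _; rewrite poisson_term_at0.
Qed.

End LevelProbabilities.

(** * Probabilities of the levels below c *)

Section LowLevels.
Context (R : realType) (c i : nat) (mu : R).

(** The partial fraction coefficients of the chain of exponential stages formed
    by the levels j, ..., c - 1, whose rates (c - k) mu are distinct. *)
Definition level_coef (j k : nat) : R :=
  (-1) ^+ (c - j - k) * ((c - 1)`!)%:R
    / (((k - 1)`!)%:R * ((c - j - k)`!)%:R * (j`!)%:R).

(** The probability of level j < c at time t, starting from i + 1 customers. *)
Definition low_prob (j : nat) (t : R) : R :=
  \sum_(1 <= k < (c - j).+1) level_coef j k * (c%:R / k%:R) ^+ (i - c + 2)
    * poisson_tail (k%:R * mu) (c%:R * mu) (i - c + 1).+1 t.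

(** The sum is (c-1)! / (j! n!) times the binomial expansion of (-1 + 1)^n, with
    n = c - j - 1.  So the flow out of level c enters level c - 1 only. *)
Lemma sum_level_coef j : (j < c)%N ->
  \sum_(1 <= k < (c - j).+1) level_coef j k = (j.+1 == c)%:R.
Proof.
move=> jc; pose n := (c - j.+1)%N.
have e : (c - j = n.+1)%N by rewrite /n; lia.
have factNZ k : (k`!)%:R != 0 :> R by rewrite pnatr_eq0 -lt0n fact_gt0.
transitivity (((c - 1)`!)%:R / ((n`!)%:R * (j`!)%:R) * (- 1 + 1) ^+ n : R).
  rewrite exprDn mulr_sumr e big_add1 /= big_mkord; apply: eq_bigr => k _.
  have kn : (k <= n)%N by rewrite -ltnS.
  rewrite /level_coef e !subn1 /= subSS expr1n mulr1 -(mulr_natr (_ ^+ _)).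
  have -> : 'C(n, k)%:R = (n`!)%:R / ((k`!)%:R * ((n - k)`!)%:R) :> R.
    rewrite -(bin_fact kn) !natrM; field; by rewrite !factNZ.
  field; by rewrite !factNZ.
rewrite addNr expr0n; have [jc1|jc1] := eqVneq j.+1 c.
  rewrite (_ : n = 0)%N /=; last by rewrite /n; lia.
  rewrite fact0 mul1r mulr1 -jc1 subn1 /= divff//.
by rewrite (_ : (n == 0)%N = false) ?mulr0//; rewrite /n; lia.
Qed.

(** Turns the excess c - j - k of the decay rate of a tail over the service rate
    of level j into the flow from level j + 1. *)
Lemma level_coefS j k : (0 < k)%N -> (j + k < c)%N ->
  (c%:R - j%:R - k%:R) * level_coef j k = - (j.+1%:R * level_coef j.+1 k).
Proof.
move=> k0 jkc; pose n := (c - j.+1 - k)%N.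
have factNZ l : (l`!)%:R != 0 :> R by rewrite pnatr_eq0 -lt0n fact_gt0.
have e : (c - j - k = n.+1)%N by rewrite /n; lia.
have -> : (c%:R - j%:R - k%:R = n.+1%:R :> R).
  by rewrite -e !natrB//; lia.
rewrite /level_coef e -/n factS exprS factS !natrM.
field; rewrite !factNZ !nat1r !pnatr_eq0 //.
Qed.

(** The forward equation of a level below c.  The flow into level c - 1 comes
    from level c, whose probability is a Poisson term. *)
Lemma is_derive_low_prob j (t : R) : (j < c)%N ->
  is_derive t 1 (low_prob j)
    ((if j.+1 == c then c%:R * mu * poisson_term (c%:R * mu) (c%:R * mu) (i - c + 1) t
      else j.+1%:R * mu * low_prob j.+1 t) - j%:R * mu * low_prob j t).
Proof.
move=> jc; set a := (i - c + 1)%N.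
have ea : (i - c + 2 = a.+1)%N by rewrite /a; lia.
pose T k := poisson_tail (k%:R * mu) (c%:R * mu) a.+1.
pose p := poisson_term (c%:R * mu) (c%:R * mu) a t.
pose D k := level_coef j k * (c%:R * mu * p)
  - level_coef j k * (c%:R / k%:R) ^+ a.+1 * ((c%:R - k%:R) * mu * T k t).
have dk k : k \in index_iota 1 (c - j).+1 ->
   is_derive t 1 (fun t => level_coef j k * (c%:R / k%:R) ^+ a.+1 * T k t) (D k).
  rewrite mem_index_iota => /andP[k0 _].
  have dT := is_derive_poisson_tail (k%:R * mu) (c%:R * mu) a t.
  have := is_deriveZ (level_coef j k * (c%:R / k%:R) ^+ a.+1) dT.
  move=> h; apply: is_derive_eq; rewrite /D /p /GRing.scale/= mulrBr.
  rewrite -mulrBl; congr (_ - _).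
  have kNZ : k%:R != 0 :> R by rewrite pnatr_eq0 -lt0n.
  (* The factor (c / k)^a makes the source independent of k. *)
  have -> : poisson_term (c%:R * mu) (c%:R * mu) a t
      = (c%:R / k%:R) ^+ a * poisson_term (k%:R * mu) (c%:R * mu) a t.
    rewrite /poisson_term !mulrA -exprMn; congr (_ ^+ _ * _ / _); by field.
  by rewrite exprS; field.
rewrite /low_prob ea.
have := is_derive_sum_seq dk => hS; apply: is_derive_eq.
rewrite /D sumrB -mulr_suml sum_level_coef//.
have tailE : \sum_(1 <= k < (c - j).+1)
    level_coef j k * (c%:R / k%:R) ^+ a.+1 * ((c%:R - k%:R) * mu * T k t) =
  j%:R * mu * low_prob j t - (if j.+1 == c then 0 else j.+1%:R * mu * low_prob j.+1 t).
  transitivity (j%:R * mu * low_prob j t + \sum_(1 <= k < (c - j).+1)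
     mu * (c%:R / k%:R) ^+ a.+1 * T k t * ((c%:R - j%:R - k%:R) * level_coef j k)).
    rewrite /low_prob ea mulr_sumr -big_split; apply: eq_bigr => k _ /=.
    rewrite /T; ring.
  (* For k = c - j the tail decays at exactly the service rate of level j. *)
  congr (_ + _); rewrite big_nat_recr/=; last by lia.
  rewrite (_ : c%:R - j%:R - (c - j)%:R = 0 :> R); last first.
    by rewrite natrB ?subrr// ltnW.
  rewrite mul0r mulr0 addr0; case: eqP => [jc1|/eqP jc1].
    by rewrite big_geq ?oppr0//; lia.
  rewrite /low_prob ea (_ : (c - j.+1).+1 = (c - j)%N); last by lia.
  rewrite mulr_sumr -sumrN; apply: eq_big_nat => k /andP[k0 kc].
  rewrite level_coefS//; last by lia.
  rewrite /T; ring.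
rewrite tailE /low_prob ea -/p.
by case: ifP => _; rewrite /=; ring.
Qed.

Lemma low_prob_at0 j : low_prob j 0 = 0.
Proof.
by rewrite /low_prob big1_seq// => k _; rewrite poisson_tail_at0 mulr0.
Qed.
End LowLevels.

(** * Distribution functions of the departure times *)

Section PassageTimes.
Context (R : realType) (c i : nat) (mu : R).
Hypothesis ci : (c <= i)%N.

Definition service_rate (l : nat) : R := (minn l c)%:R * mu.

Definition level_prob (l : nat) (t : R) : R :=
  if (c <= l)%N then poisson_term (c%:R * mu) (c%:R * mu) (i.+1 - l) t
  else low_prob c i mu l t.

(** The k-th departure has occurred by time t when none of the first k levels
    i + 1, i, ... is occupied. *)
Definition passage_cdf (k : nat) (t : R) : R :=
  1 - \sum_(0 <= l < k) level_prob (i.+1 - l) t.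

Lemma level_prob_at0 l : (l <= i.+1)%N -> level_prob l 0 = (l == i.+1)%:R.
Proof.
move=> li; rewrite /level_prob; case: ifPn => cl.
  by rewrite poisson_term_at0; congr (_%:R); congr nat_of_bool; lia.
by rewrite low_prob_at0; case: eqP => // lE; move: cl; rewrite lE; lia.
Qed.

Lemma is_derive_level_prob_top (t : R) :
  is_derive t 1 (level_prob i.+1) (- (service_rate i.+1 * level_prob i.+1 t)).
Proof.
rewrite (_ : level_prob i.+1 = poisson_term (c%:R * mu) (c%:R * mu) 0); last first.
  by apply/funext => s; rewrite /level_prob ifT ?subnn//; lia.
have := is_derive_poisson_term0 (c%:R * mu) (c%:R * mu) t.
move=> h; apply: is_derive_eq.
by rewrite /service_rate (minn_idPr _) ?mulNr//; lia.
Qed.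

Lemma is_derive_level_prob l (t : R) : (l <= i)%N ->
  is_derive t 1 (level_prob l)
    (service_rate l.+1 * level_prob l.+1 t - service_rate l * level_prob l t).
Proof.
move=> li; have [cl|lc] := leqP c l.
  have e : (i.+1 - l = (i - l).+1)%N by lia.
  have := is_derive_poisson_term (c%:R * mu) (c%:R * mu) (i - l) t.
  rewrite -e (_ : poisson_term _ _ (i.+1 - l) = level_prob l) => [h|]; last first.
    by apply/funext => s; rewrite /level_prob cl.
  apply: is_derive_eq; rewrite /service_rate !(minn_idPr _)//; try lia.
  by rewrite [level_prob l.+1 t]/level_prob ifT ?subSS//; lia.
have := is_derive_low_prob i mu t lc.
rewrite (_ : low_prob c i mu l = level_prob l) => [h|]; last first.
  by apply/funext => s; rewrite /level_prob leqNgt lc.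
apply: is_derive_eq; congr (_ - _).
  rewrite /service_rate /level_prob; case: eqP => [lE|lE].
    by rewrite lE minnn leqnn; congr (_ * poisson_term _ _ _ _); lia.
  by rewrite (minn_idPl _)// leqNgt ifF//; lia.
by rewrite /service_rate (minn_idPl _)//; lia.
Qed.

Lemma passage_cdfS k t :
  passage_cdf k.+1 t = passage_cdf k t - level_prob (i.+1 - k) t.
Proof. by rewrite /passage_cdf big_nat_recr//= opprD addrA. Qed.

(** Summing the forward equations of the first levels telescopes to the flow
    out of the last of them. *)
Lemma is_derive_passage_cdf k (t : R) : (k <= i.+1)%N ->
  is_derive t 1 (passage_cdf k.+1)
    (service_rate (i.+1 - k) * (passage_cdf k t - passage_cdf k.+1 t)).
Proof.
rewrite passage_cdfS opprB addrCA subrr addr0.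
elim: k => [|k IH] ki.
  rewrite (_ : passage_cdf 1 = cst 1 - level_prob i.+1); last first.
    by apply/funext => s; rewrite /passage_cdf big_nat1 subn0.
  have h := is_deriveB (is_derive_cst (1 : R) t 1) (is_derive_level_prob_top t).
  by apply: is_derive_eq; rewrite sub0r opprK subn0.
have ki' : (i.+1 - k.+1 <= i)%N by lia.
have h := is_deriveB (IH (ltnW ki)) (is_derive_level_prob t ki').
rewrite (_ : passage_cdf k.+2 = passage_cdf k.+1 - level_prob (i.+1 - k.+1)).
  apply: is_derive_eq; rewrite (_ : (i.+1 - k.+1).+1 = (i.+1 - k)%N); last by lia.
  by rewrite opprB addrCA subrr addr0.
by apply/funext => s; rewrite passage_cdfS.
Qed.

Lemma passage_cdf0 t : passage_cdf 0 t = 1.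
Proof. by rewrite /passage_cdf big_nil subr0. Qed.

Lemma passage_cdf_at0 k : (k <= i.+1)%N -> passage_cdf k.+1 0 = 0.
Proof.
move=> ki; rewrite /passage_cdf big_nat_recl//= subn0 level_prob_at0// eqxx.
rewrite big_nat big1 ?addr0 ?subrr// => l /andP[_ lk].
by rewrite level_prob_at0 ?leq_subr// (_ : _ == _ = false)//; lia.
Qed.

Lemma continuous_passage_cdf k : (k <= i.+2)%N -> continuous (passage_cdf k).
Proof.
case: k => [_|k ki] t.
  rewrite (_ : passage_cdf 0 = cst 1); first exact: cvg_cst.
  by apply/funext => s; rewrite passage_cdf0.
apply: differentiable_continuous; apply/derivable1_diffP.
by have [] := is_derive_passage_cdf t ki.
Qed.

End PassageTimes.

(** * Integration against the inter-arrival law *)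

Section Transforms.
Context (R : realType) (A : probability R R).

(** One term of the exponential series bounds the power; the integrands are
    therefore bounded on [0, +oo[, and integrable against A. *)
Lemma exprn_expR_le (r : nat) (s t : R) : 0 < s -> 0 <= t ->
  t ^+ r * expR (- (s * t)) <= (r`!)%:R / s ^+ r.
Proof.
move=> s0 t0; have st0 : 0 <= s * t by rewrite mulr_ge0// ltW.
have fact_pos k : 0 < (k`!)%:R :> R by rewrite ltr0n fact_gt0.
rewrite expRN ler_pdivrMr ?expR_gt0// mulrAC ler_pdivlMr ?exprn_gt0//.
rewrite mulrC -exprMn -ler_pdivrMl// mulrC.
case: r => [|r]; first by rewrite expr0 fact0 divr1 -[leLHS]expR0 ler_expR.
by apply: le_trans (expR_ge1Dxn r st0); rewrite lerDr.
Qed.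

Lemma integrable_exprn_expR (r : nat) (s : R) : 0 < s ->
  A.-integrable `[0, +oo[ (fun t => (t ^+ r * expR (- (s * t)))%:E).
Proof.
move=> s0.
apply: (@le_integrable _ _ _ _ _ _ _ (cst ((r`!)%:R / s ^+ r)%:E)) => //=.
- apply/measurable_EFinP/measurable_funTS; apply: measurable_funM.
    exact: measurable_funX.
  apply: continuous_measurable_fun => t.
  apply: (@continuous_comp _ _ _ (fun t => - (s * t)) expR).
    by apply: cvgN; apply: cvgM => //; exact: cvg_cst.
  exact: continuous_expR.
- move=> t; rewrite in_itv/= andbT => t0; rewrite lee_fin.
  rewrite ger0_norm ?mulr_ge0 ?exprn_ge0 ?expR_ge0//.
  by rewrite (le_trans (exprn_expR_le r s0 t0))// ler_norm.
- apply: (integrableS measurableT) => //.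
  exact: finite_measure_integrable_cst.
Qed.

Lemma Rintegral_sum_seq (I : eqType) (s : seq I) (f : I -> R -> R) (D : set R) :
  measurable D -> (forall k, k \in s -> A.-integrable D (EFin \o f k)) ->
  A.-integrable D (fun t => (\sum_(k <- s) f k t)%:E) /\
  \int[A]_(t in D) (\sum_(k <- s) f k t) = \sum_(k <- s) \int[A]_(t in D) f k t.
Proof.
move=> mD; elim: s => [|k s IH] fint.
  rewrite big_nil; split.
    rewrite (_ : (fun _ => _) = cst 0%E); first exact: integrable0.
    by apply/funext => t; rewrite big_nil.
  rewrite (_ : (fun _ => _) = cst 0) ?Rintegral_cst ?mul0r//.
  by apply/funext => t; rewrite big_nil.
have ik : A.-integrable D (EFin \o f k) by apply: fint; rewrite inE eqxx.
have [is_ sE] := IH (fun l ls => fint l (mem_behead (s := k :: s) ls)).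
split.
  rewrite (_ : (fun _ => _) =
    ((EFin \o f k) \+ (fun t => (\sum_(k <- s) f k t)%:E))%E).
    exact: integrableD.
  by apply/funext => t; rewrite big_cons EFinD.
rewrite big_cons -sE -RintegralD//; apply: eq_Rintegral => t _.
by rewrite big_cons.
Qed.

Lemma Rintegral_poisson_term (w nu : R) (r : nat) : 0 < nu ->
  A.-integrable `[0, +oo[ (EFin \o poisson_term w nu r) /\
  \int[A]_(t in `[0, +oo[) poisson_term w nu r t
    = w ^+ r * lst_moment A r nu / (r`!)%:R.
Proof.
move=> nu0; have int := integrable_exprn_expR r nu0.
have e : poisson_term w nu r =
    (fun t => w ^+ r / (r`!)%:R * (t ^+ r * expR (- (nu * t)))).
  by apply/funext => t; rewrite /poisson_term exprMn; ring.
split.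
  rewrite e (_ : EFin \o _ = fun t => ((w ^+ r / (r`!)%:R)%:E *
    (t ^+ r * expR (- (nu * t)))%:E)%E); first exact: integrableZl.
  by apply/funext => t; rewrite /= EFinM.
by rewrite e RintegralZl// /lst_moment; ring.
Qed.

Lemma Rintegral_poisson_tail (w nu : R) (a : nat) : 0 < nu -> w < nu ->
  A.-integrable `[0, +oo[ (EFin \o poisson_tail w nu a) /\
  \int[A]_(t in `[0, +oo[) poisson_tail w nu a t =
    lst A (nu - w) - \sum_(0 <= r < a) w ^+ r * lst_moment A r nu / (r`!)%:R.
Proof.
move=> nu0 wnu.
have [isum sumE] := @Rintegral_sum_seq _ (index_iota 0 a)
  (poisson_term w nu) `[0, +oo[%classic (measurable_itv _)
  (fun r _ => (Rintegral_poisson_term w r nu0).1).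
have nuw : 0 < nu - w by rewrite subr_gt0.
have iexp : A.-integrable `[0, +oo[ (fun t => (expR (- ((nu - w) * t)))%:E).
  apply: eq_integrable (integrable_exprn_expR 0 nuw) => // t _.
  by rewrite expr0 mul1r.
split.
  rewrite (_ : EFin \o _ = ((fun t => (expR (- ((nu - w) * t)))%:E) \-
    (fun t => (\sum_(0 <= r < a) poisson_term w nu r t)%:E))%E).
    exact: integrableB.
  by apply/funext => t; rewrite /= -EFinB.
rewrite /poisson_tail RintegralB// sumE; congr (_ - _).
by apply: eq_bigr => r _; have [] := Rintegral_poisson_term w r nu0.
Qed.

Lemma Rintegral_low_prob (c i j : nat) (mu : R) : 0 < mu -> (j < c)%N -> 
  (0 < j)%N ->
  \int[A]_(t in `[0, +oo[) low_prob c i mu j t =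
  \sum_(1 <= k < (c - j).+1) level_coef R c j k * (c%:R / k%:R) ^+ (i - c + 2)
    * (lst A ((c - k)%:R * mu)
       - \sum_(0 <= r < (i - c + 1).+1)
           (k%:R * mu) ^+ r * lst_moment A r (c%:R * mu) / (r`!)%:R).
Proof.
move=> mu0 jc j0.
have nu0 : 0 < c%:R * mu by rewrite mulr_gt0// ltr0n; lia.
pose f k t := level_coef R c j k * (c%:R / k%:R) ^+ (i - c + 2)
  * poisson_tail (k%:R * mu) (c%:R * mu) (i - c + 1).+1 t.
have wnu k : k \in index_iota 1 (c - j).+1 -> k%:R * mu < c%:R * mu.
  by rewrite mem_index_iota => /andP[_ kc]; rewrite ltr_pM2r// ltr_nat; lia.
have fint k : k \in index_iota 1 (c - j).+1 ->
    A.-integrable `[0, +oo[ (EFin \o f k).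
  move=> /wnu /(Rintegral_poisson_tail (i - c + 1).+1 nu0)[int _].
  rewrite (_ : EFin \o _ = fun t =>
    ((level_coef R c j k * (c%:R / k%:R) ^+ (i - c + 2))%:E *
    (poisson_tail (k%:R * mu) (c%:R * mu) (i - c + 1).+1 t)%:E)%E).
    exact: integrableZl.
  by apply/funext => t; rewrite /= EFinM.
have [_ ->] := @Rintegral_sum_seq _ (index_iota 1 (c - j).+1) f _
  (measurable_itv `[0, +oo[) fint.
apply: eq_big_seq => k kc; rewrite /f.
have [int intE] := Rintegral_poisson_tail (i - c + 1).+1 nu0 (wnu _ kc).
rewrite RintegralZl// intE -mulrBl natrB//.
by move: kc; rewrite mem_index_iota; lia.
Qed.

End Transforms.

(** * Counting departures *)

Section Counting.

(** The indices satisfying a downward closed predicate form an initial segment,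
    so their number is read off at its end. *)
Lemma sum_initial_segment (p : nat -> bool) (m K : nat) :
  (forall k, (0 < k < m)%N -> p k.+1 -> p k) -> (0 < K < m)%N ->
  ((\sum_(1 <= k < m.+1) p k)%N == K) = p K && ~~ p K.+1.
Proof.
move=> pS /andP[K0 Km].
have down a b : (0 < a)%N -> (a <= b <= m)%N -> p b -> p a.
  move=> a0 /andP[ab bm]; rewrite -(subnKC ab) in bm *.
  elim: (b - a)%N bm => [|l IH]; first by rewrite addn0.
  rewrite addnS => alm pl; apply: IH; first exact: ltnW.
  by apply: pS pl; rewrite alm andbT ltn_addr.
have sumE (b : bool) (l n : nat) : (forall k, (l <= k < n)%N -> p k = b) ->
    (\sum_(l <= k < n) p k)%N = (b * (n - l))%N.
  move=> pb; transitivity (\sum_(l <= k < n) nat_of_bool b)%N.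
    by apply: eq_big_nat => k /pb ->.
  by rewrite sum_nat_const_nat mulnC.
have [pK1|pK1] := boolP (p K.+1).
  rewrite andbF (@big_cat_nat _ _ _ K.+2)//=.
  rewrite (sumE true); last first.
    by move=> k /andP[k0 kK]; apply: down pK1; rewrite // -ltnS kK.
  by rewrite mul1n subn1 /= gtn_eqF// ltn_addr.
have [pK|pK] := boolP (p K) => /=.
  rewrite (@big_cat_nat _ _ _ K.+1)//=; last exact: ltnW.
  rewrite (sumE true); last first.
    by move=> k /andP[k0 kK]; apply: down pK; rewrite // -ltnS kK ltnW.
  rewrite (sumE false) ?addn0; first by rewrite mul1n subn1 eqxx.
  move=> k /andP[Kk km]; apply/negbTE; apply: contraNN pK1.
  by apply: down; rewrite // Kk -ltnS km.
rewrite (@big_cat_nat _ _ _ K)//=; last exact: leqW (ltnW _).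
rewrite (sumE false K m.+1); last first.
  move=> k /andP[Kk km]; apply/negbTE; apply: contraNN pK.
  by apply: down; rewrite // Kk -ltnS km.
rewrite addn0; apply/negbTE; rewrite neq_ltn; apply/orP; left.
apply: (@leq_ltn_trans (\sum_(1 <= k < K) 1)%N).
  by apply: leq_sum => k _; case: (p k).
by rewrite sum_nat_const_nat muln1 subn1 ltn_predL.
Qed.

Context (R : realType).

Lemma completion_timeS (h : nat -> R) (m k : nat) :
  completion_time h m k.+1 = completion_time h m k + h (m - k)%N.
Proof. by rewrite /completion_time big_nat_recr. Qed.

(** The truncated subtraction causes no ambiguity because j > 0. *)
Lemma completions_eq (h : nat -> R) (m j : nat) (t : R) :
  (forall l, (0 < l <= m)%N -> 0 <= h l) -> (0 < j < m)%N ->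
  (m - completions h m t == j)%N =
  (completion_time h m (m - j) <= t) && ~~ (completion_time h m (m - j).+1 <= t).
Proof.
move=> h0 /andP[j0 jm].
rewrite -(@sum_initial_segment (fun k => completion_time h m k <= t) m) /completions.
- by apply/eqP/eqP; lia.
- move=> k /andP[k0 km]; rewrite completion_timeS; apply: le_trans.
  by rewrite lerDl; apply: h0; lia.
- by lia.
Qed.

Lemma measurable_completion_time d (T : measurableType d) (h : nat -> T -> R)
    (m k : nat) :
  (forall l, (l < k)%N -> measurable_fun setT (h (m - l)%N)) ->
  measurable_fun setT (fun w => completion_time (h ^~ w) m k).
Proof.
elim: k => [|k IH] mh.
  rewrite (_ : (fun w => _) = cst 0); first exact: measurable_cst.
  by apply/funext => w; rewrite /completion_time big_nil.
rewrite (_ : (fun w => _) =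
    (fun w => completion_time (h ^~ w) m k + h (m - k)%N w)); last first.
  by apply/funext => w; rewrite completion_timeS.
apply: measurable_funD; last exact: mh.
by apply: IH => l lk; apply: mh; rewrite ltnS ltnW.
Qed.

Lemma measurable_completions d (T : measurableType d) (h : nat -> T -> R)
    (t : T -> R) (m : nat) :
  (forall l, measurable_fun setT (h l)) -> measurable_fun setT t ->
  measurable_fun setT (fun w => completions (h ^~ w) m (t w)).
Proof.
move=> mh mt; (* The starting level m stays fixed while the number of summands grows. *)
suff : forall b, measurable_fun setT (fun w =>
    (\sum_(1 <= k < b.+1) (completion_time (h ^~ w) m k <= t w)%R)%N) by exact.
elim=> [|b IH].
  rewrite (_ : (fun w => _) = cst 0%N); first exact: measurable_cst.
  by apply/funext => w; rewrite big_geq.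
rewrite (_ : (fun w => _) = (fun w =>
    (\sum_(1 <= k < b.+1) (completion_time (h ^~ w) m k <= t w)%R) +
    (completion_time (h ^~ w) m b.+1 <= t w)%R)%N); last first.
  by apply/funext => w; rewrite big_nat_recr.
apply: measurable_fun_addn; first exact: IH.
apply: (@measurableT_comp _ _ _ _ _ _ nat_of_bool) => //.
apply: measurable_fun_ler => //.
exact: measurable_completion_time.
Qed.

End Counting.

(** * Events determined by groups of inputs *)

Section Inputs.
Context d (Omega : measurableType d) (R : realType) (P : probability Omega R).
Context (c : nat) (lambda mu : R) (A : probability R R).
Variable M : GIMc P c lambda mu A.

(** The classes of events carried by the inputs, as in the independence
    hypothesis of the model. *)
Definition input_events (x : unit + (nat + nat * nat)) : set (set Omega) :=
  match x with
  | inl _ => preimage_set_system setT (initial M) measurable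
  | inr (inl n) => preimage_set_system setT (interarrival M n) measurable
  | inr (inr (n, m)) => preimage_set_system setT (holding M n m) measurable
  end.

Lemma input_events_measurable x : input_events x `<=` measurable.
Proof.
by case: x => [?|[?|[? ?]]] _ [B mB <-]; rewrite setTI; exact: measurable_funPTI.
Qed.

Lemma input_events_setI x : setI_closed (input_events x).
Proof.
by case: x => [?|[?|[? ?]]] _ _ [B mB <-] [C mC <-]; exists (B `&` C);
  rewrite ?setTI//; exact: measurableI.
Qed.

Notation inputs := (unit + (nat + nat * nat))%type.
Notation known := (events_of input_events).
Notation knownT := (events_type input_events).

Lemma known_measurable (U : set inputs) : known U `<=` measurable.
Proof. exact/events_of_measurable/input_events_measurable. Qed.

Lemma known_independent (U V : set inputs) E1 E2 : U `&` V = set0 ->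
  known U E1 -> known V E2 -> P (E1 `&` E2) = (P E1 * P E2)%E.
Proof.
apply: events_of_independent.
- exact: input_events_measurable.
- exact: input_events_setI.
- exact: inputs_independent M.
Qed.

Lemma measurable_interarrival (U : set inputs) n : U (inr (inl n)) ->
  measurable_fun [set: knownT U] (interarrival M n).
Proof.
move=> Un _ B mB; apply: (events_of_sub (F := input_events) Un).
by exists B.
Qed.

Lemma measurable_holding (U : set inputs) n m : U (inr (inr (n, m))) ->
  measurable_fun [set: knownT U] (holding M n m).
Proof.
move=> Un _ B mB; apply: (events_of_sub (F := input_events) Un).
by exists B.
Qed.

Definition past (n : nat) : set inputs := [set x | match x with
  | inl _ => true
  | inr (inl k) => k < n
  | inr (inr (k, _)) => k < n
  end]%N.

Definition period (n : nat) : set inputs := [set x | match x with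
  | inl _ => false
  | inr (inl k) => k == n
  | inr (inr (k, _)) => k == n
  end]%N.

(** The holding times of period [n] at levels above [l]: those that precede the
    arrival of the process at level [l]. *)
Definition service_above (n l : nat) : set inputs := [set x | match x with
  | inr (inr (k, l')) => (k == n) && (l < l')
  | _ => false
  end]%N.

Lemma known_departures (U : set inputs) n m j : period n `<=` U ->
  known U [set w | (m - completions (fun l => holding M n l w) m
                          (interarrival M n w))%N = j].
Proof.
move=> nU.
have mc : measurable_fun [set: knownT U] (fun w =>
    (m - completions (fun l => holding M n l w) m (interarrival M n w))%N).
  apply: measurable_fun_subn; first exact: measurable_cst.
  apply: (measurable_completions (T := knownT U) (h := fun l => holding M n l)).
    by move=> l; apply: measurable_holding; apply: nU; rewrite /period /=.
  by apply: measurable_interarrival; apply: nU; rewrite /period /=.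
have := mc measurableT [set j] I.
by rewrite setTI.
Qed.

(** X_n is countably valued, so splitting according to its value reduces the
    random starting level of the period to a fixed one. *)
Lemma known_queue_length n j : known (past n) [set w | queue_length M n w = j].
Proof.
elim: n j => [|n IH] j.
  apply: (events_of_sub (F := input_events) (i := inl tt)) => //.
  by exists [set j]; rewrite ?setTI.
rewrite (_ : [set w | _] = \bigcup_k ([set w | queue_length M n w = k] `&`
  [set w | (k.+1 - completions (fun l => holding M n l w) k.+1
                          (interarrival M n w))%N = j])); last first.
  apply/seteqP; split => [w /= wj|w /= [k _ /= [<-]]] //.
  by exists (queue_length M n w).
apply: (@bigcupT_measurable _ (knownT (past n.+1))) => k.
apply: (@measurableI _ (knownT (past n.+1))).
  apply: (@events_ofS _ _ _ input_events (past n)); last exact: IH.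
  by move=> [//|[l|[l ?]]] /=; exact: leqW.
apply: known_departures => -[//|[l|[l ?]]] /= /eqP ->; exact: ltnSn.
Qed.

Lemma measurable_service_time (U : set inputs) n m k :
  service_above n (m - k) `<=` U -> (k <= m)%N ->
  measurable_fun [set: knownT U]
    (fun w => completion_time (fun l => holding M n l w) m k).
Proof.
move=> nU km.
apply: (measurable_completion_time (T := knownT U) (h := fun l => holding M n l)).
move=> l lk; apply: measurable_holding; apply: nU.
by rewrite /service_above /= eqxx /=; lia.
Qed.

End Inputs.

(** * Departures during one inter-arrival period *)

Section Departures.
Context d (Omega : measurableType d) (R : realType) (P : probability Omega R).
Context (c : nat) (lambda mu : R) (A : probability R R).
Variable M : GIMc P c lambda mu A.

Notation inputs := (unit + (nat + nat * nat))%type.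
Notation known := (events_of (input_events M)).
Notation knownT := (events_type (input_events M)).

Definition service_time (n m k : nat) (w : Omega) : R :=
  completion_time (fun l => holding M n l w) m k.

Lemma measurable_service_timeT n m k : (k <= m)%N ->
  measurable_fun setT (service_time n m k).
Proof.
move=> km _ B mB.
apply: (@known_measurable _ _ _ _ _ _ _ _ M (service_above n (m - k))).
exact: measurable_service_time.
Qed.

(** The k-th departure time depends on the levels above i + 1 - k only, hence is
    independent of the holding time at that level, which is the next stage. *)
Lemma service_time_cdf n i k : (c <= i)%N -> (k <= i.+1)%N ->
  pos_cdf P (service_time n i.+1 k) (passage_cdf c i mu k).
Proof.
move=> ci; elim: k => [|k IH] ki.
  move=> t; rewrite passage_cdf0.
  have -> : service_time n i.+1 0 = cst 0.
    by apply/funext => w; rewrite /service_time /completion_time big_nil.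
  case: ifPn => t0.
    by rewrite (_ : [set _ | _] = setT) ?probability_setT//; apply/seteqP.
  by rewrite (_ : [set _ | _] = set0) ?measure0//; apply/seteqP; split=> w //=;
    exact/negP.
pose X := mfun_of (measurable_service_timeT n (ltnW ki)).
pose Y := holding M n (i.+1 - k).
rewrite (_ : service_time n i.+1 k.+1 = X \+ Y); last first.
  by apply/funext => w; rewrite /service_time completion_timeS.
have l0 : (0 < i.+1 - k)%N by lia.
apply: (@pos_cdf_add _ _ _ _ X Y (service_rate c mu (i.+1 - k)) (passage_cdf c i mu k)).
- by rewrite /service_rate mulr_gt0 ?(mu_gt0 M)// ltr0n leq_min l0 (servers_gt0 M).
- move=> B C mB mC.
  apply: (@known_independent _ _ _ _ _ _ _ _ M (service_above n (i.+1 - k))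
    [set inr (inr (n, (i.+1 - k)%N))]).
  + apply/seteqP; split => // x [] /[swap] -> /=; rewrite ltnn andbF//.
  + have := measurable_service_time (M := M) (U := service_above n (i.+1 - k))
      (fun _ h => h) (ltnW ki).
    by move=> /(_ measurableT B mB); rewrite setTI.
  + apply: (events_of_sub (F := input_events M)
      (i := inr (inr (n, (i.+1 - k)%N)))) => //.
    by exists C; rewrite ?setTI.
- by move=> B mB; exact: holding_law.
- by apply: continuous_passage_cdf => //; lia.
- by move=> t; apply: is_derive_passage_cdf => //; exact: ltnW.
- by apply: passage_cdf_at0 => //; exact: ltnW.
- by apply: IH; exact: ltnW.
Qed.

(** Read off from the probabilities that the function represents; the closed
    form shows neither bound. *)
Lemma passage_cdf_bounds i k t : (c <= i)%N -> (k <= i.+1)%N -> 0 <= t ->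
  0 <= passage_cdf c i mu k t <= 1.
Proof.
move=> ci ki t0; have := service_time_cdf 0 ci ki t; rewrite t0 => e.
rewrite -!lee_fin -e measure_ge0 probability_le1//.
rewrite -[X in measurable X]setTI.
apply: (measurable_fun_le measurableT); last exact: measurable_cst.
exact: measurable_service_timeT.
Qed.

Lemma integrable_passage_cdf i k : (c <= i)%N -> (k <= i.+1)%N ->
  A.-integrable `[0, +oo[ (EFin \o passage_cdf c i mu k).
Proof.
move=> ci ki; apply: (@le_integrable _ _ _ _ _ _ _ (cst 1%E)) => //=.
- apply/measurable_EFinP; apply: measurable_funTS; apply: continuous_measurable_fun.
  exact: (continuous_passage_cdf (mu := mu) ci (leqW ki)).
- move=> t; rewrite in_itv/= andbT => t0; rewrite lee_fin normr1.
  by have /andP[? ?] := passage_cdf_bounds ci ki t0; rewrite ger0_norm.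
- apply: (integrableS measurableT) => //.
  exact: finite_measure_integrable_cst.
Qed.

Lemma service_time_before_arrival n i k : (c <= i)%N -> (k <= i.+1)%N ->
  P [set w | service_time n i.+1 k w <= interarrival M n w] =
  (\int[A]_(t in `[0%R, +oo[) (passage_cdf c i mu k t)%:E)%E.
Proof.
move=> ci ki; pose X := mfun_of (measurable_service_timeT n ki).
have XT (B C : set R) : measurable B -> measurable C ->
    P (X @^-1` B `&` interarrival M n @^-1` C) =
    (P (X @^-1` B) * P (interarrival M n @^-1` C))%E.
  move=> mB mC.
  apply: (@known_independent _ _ _ _ _ _ _ _ M (service_above n (i.+1 - k))
    [set inr (inl n)]).
  + by apply/seteqP; split => // x [] /[swap] ->.
  + have := measurable_service_time (M := M) (U := service_above n (i.+1 - k))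
      (fun _ h => h) ki.
    by move=> /(_ measurableT B mB); rewrite setTI.
  + apply: (events_of_sub (F := input_events M) (i := inr (inl n))) => //.
    by exists C; rewrite ?setTI.
rewrite (prob_le_independent XT (g := id))//.
transitivity (\int[A]_y P [set w | (X w <= y)%R])%E.
  by apply: eq_measure_integral => B mB _; exact: interarrival_law.
rewrite [RHS]integral_mkcond; apply: eq_integral => t _.
rewrite patchE mem_setE in_itv/= andbT.
by rewrite (service_time_cdf n ci ki t); case: ifP.
Qed.

Lemma holding_ge0 n l : (0 < l)%N -> P [set w | holding M n l w < 0] = 0%E.
Proof.
move=> l0; have := holding_law M n l0 (measurable_itv `]-oo, 0[).
rewrite /distribution /pushforward /= /exponential_prob.
rewrite integral0_eq; last first.
  by move=> x /=; rewrite in_itv/= => x0; rewrite lt0_exponential_pdf.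
by move=> <-; congr (P _); apply/seteqP; split => w /=; rewrite in_itv.
Qed.

(** Off the null event that some holding time is negative, the departure times
    increase, and the event that S_K precedes the arrival splits according to
    whether the next departure does too. *)
Lemma departures_prob n i j : (c <= i)%N -> (0 < j)%N -> (j < c)%N ->
  fine (P [set w | (i.+1 - completions (fun l => holding M n l w) i.+1
                      (interarrival M n w))%N = j]) =
  \int[A]_(t in `[0, +oo[) low_prob c i mu j t.
Proof.
move=> ci j0 jc; set E := [set w | _ = j].
pose N := \bigcup_l [set w | holding M n l.+1 w < 0].
have mneg l : measurable [set w | holding M n l.+1 w < 0].
  rewrite (_ : [set w | _] = holding M n l.+1 @^-1` `]-oo, 0[).
    exact: measurable_funPTI.
  by apply/seteqP; split => w /=; rewrite in_itv.
have mN : measurable N by exact: bigcupT_measurable.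
have PN : P N = 0%E.
  apply/negligibleP => //; apply: negligible_bigcup => l; apply/negligibleP => //.
  exact: holding_ge0.
have mE : measurable E.
  by apply: (@known_measurable _ _ _ _ _ _ _ _ M (period n)); exact: known_departures.
pose S k := [set w | service_time n i.+1 k w <= interarrival M n w].
have mS k : (k <= i.+1)%N -> measurable (S k).
  move=> ki; rewrite -[X in measurable X]setTI.
  by apply: measurable_fun_le => //; exact: measurable_service_timeT.
pose K := (i.+1 - j)%N.
have Ki : (K < i.+1)%N by rewrite /K; lia.
have drop B : measurable B -> P B = P (B `\` N).
  move=> mB; have BN0 : P (B `&` N) = 0%E.
    apply/eqP; rewrite eq_le measure_ge0 andbT -PN le_measure ?inE//.
    exact: measurableI.
  by rewrite (measureDI P mB mN) [X in (_ + X)%E]BN0 adde0.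
have S_split : P (S K) = (P E + P (S K.+1))%E.
  rewrite (drop _ (mS _ (ltnW Ki))) (drop _ (mS _ Ki)) (drop _ mE).
  have off_N w : ~ N w -> (E w <-> S K w /\ ~ S K.+1 w) /\ (S K.+1 w -> S K w).
    move=> Nw; have h0 l : (0 < l <= i.+1)%N -> 0 <= holding M n l w.
      case: l => // l _; rewrite leNgt; apply/negP => hl; apply: Nw.
      by exists l.
    have jm : (0 < j < i.+1)%N by lia.
    have := completions_eq (interarrival M n w) h0 jm => /= e; split.
      split; first by move/eqP; rewrite e => /andP[? /negP].
      by move=> [S1 /negP S2]; apply/eqP; rewrite e; apply/andP.
    rewrite /S /= /service_time completion_timeS; apply: le_trans.
    by rewrite lerDl h0// /K; lia.
  rewrite -measureU; last 3 first.
  - exact: measurableD.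
  - by apply: measurableD => //; exact: mS.
  - apply/seteqP; split => // w [[Ew Nw] [Sw _]].
    by have [[/(_ Ew)[]]] := off_N w Nw.
  congr (P _); apply/seteqP; split => [w [Sw Nw]|w [[Ew Nw]|[Sw Nw]]].
  - have [[_ EK] _] := off_N w Nw; have [SK1|SK1] := pselect (S K.+1 w).
      by right.
    by left; split => //; exact: EK.
  - by split => //; have [[/(_ Ew)[]]] := off_N w Nw.
  - by split => //; have [_] := off_N w Nw; apply.
have fin k : (k <= i.+1)%N -> P (S k) \is a fin_num.
  by move=> ki; exact/fin_num_measure/mS.
have -> : P E = (P (S K) - P (S K.+1))%E by rewrite S_split addeK// fin.
rewrite fineB ?fin// ?(ltnW Ki)//.
rewrite !service_time_before_arrival// ?(ltnW Ki)//.
rewrite -[LHS]RintegralB//; try exact: integrable_passage_cdf.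
  apply: eq_Rintegral => t _; rewrite passage_cdfS opprB addrCA subrr addr0.
  by rewrite /level_prob leqNgt (_ : (i.+1 - K = j)%N) ?jc// /K; lia.
by apply: integrable_passage_cdf => //; exact: ltnW.
Qed.

End Departures.

(** * The transition probabilities *)

Theorem lemma2p2 (d : measure_display) (Omega : measurableType d)
    (R : realType) (P : probability Omega R) (c : nat) (lambda mu : R)
    (A : probability R R) (M : GIMc P c lambda mu A) (n i j : nat)
    (reach : P [set w | queue_length M n w = i] != 0%E)
    (j_gt0 : (0 < j)%N) (jc : (j + 1 <= c)%N) (ci : (c <= i)%N) :
  transition_prob M n i j =
  \sum_(1 <= k < (c - j).+1)
    ((-1) ^+ (c - j - k) * ((c - 1)`!)%:R
       / (((k - 1)`!)%:R * ((c - j - k)`!)%:R * (j`!)%:R))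
    * (c%:R / k%:R) ^+ (i - c + 2)
    * (lst A ((c - k)%:R * mu)
       - \sum_(0 <= r < (i - c + 1).+1)
           (k%:R * mu) ^+ r * lst_moment A r (c%:R * mu) / (r`!)%:R).
Proof.
have jc' : (j < c)%N by rewrite -addn1.
rewrite -(Rintegral_low_prob A i (mu_gt0 M) jc' j_gt0).
rewrite -(departures_prob M n ci j_gt0 jc').
rewrite /transition_prob /cond_prob.
set G := [set w | queue_length M n w = i]; set E := [set w | (_ - _)%N = j].
have kG : events_of (input_events M) (past n) G by exact: known_queue_length.
have kE : events_of (input_events M) (period n) E by exact: known_departures.
have -> : [set w | queue_length M n.+1 w = j] `&` G = G `&` E.
  apply/seteqP; split => w; rewrite /G /E /= => -[]; first by move=> + Gw; rewrite Gw.
  by move=> -> Ew.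
rewrite (known_independent (M := M) _ kG kE); last first.
  apply/seteqP; split => // x [].
  by case: x => [?|[l|[l ?]]] //= + /eqP lE; rewrite lE ltnn.
have fin B : measurable B -> P B \is a fin_num by exact: fin_num_measure.
have mG : measurable G by exact: known_measurable kG.
rewrite fineM ?fin//; last exact: known_measurable kE.
by rewrite mulrC mulKf// fine_eq0 ?fin.
Qed.
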